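(* Let $C\subset\mathbf{L}^3$ be the parabolic catenoid of axis $(1,0,1)$. For every $t\in\mathbb{R}$, the dual surface $H_t(C)^\sharp$ of the image of $C$ by the hyperbolic rotation $H_t$ of axis $(1,0,0)$ is the Enneper surface.
   Context: $\mathbf{E}^3$ and $\mathbf{L}^3$ denote $\mathbb{R}^3$ with the metric $dx^2+dy^2+\epsilon\,dz^2$, with $\epsilon=1$ and $\epsilon=-1$ respectively. A (conformal) minimal surface of $\mathbf{E}^3$ ($\epsilon=1$) or maximal surface of $\mathbf{L}^3$ ($\epsilon=-1$) is given on a simply-connected domain $\Omega\subset\mathbb{C}$ by $X(z)=X(z_0)+\Re\int_{z_0}^z\phi(w)\,dw$, where the isotropic curve $\phi=2\,\partial X/\partial z:\Omega\to\mathbb{C}^3$ is holomorphic, $\phi_1^2+\phi_2^2+\epsilon\phi_3^2=0$ and $|\phi_1|^2+|\phi_2|^2+\epsilon|\phi_3|^2\not\equiv 0$ (the induced metric may degenerate at some points). Its Weierstrass representation is $(g,\omega)$ with $g=\phi_3/(\phi_1-i\phi_2)$, $\omega=(\phi_1-i\phi_2)dz$, so that $\phi\,dz=\left(\tfrac12(1-\epsilon g^2)\omega,\tfrac i2(1+\epsilon g^2)\omega,g\omega\right)$. Dual surface: if $M$ is maximal in $\mathbf{L}^3$ with isotropic curve $\psi$, then $M^\sharp$ is the minimal surface of $\mathbf{E}^3$ with isotropic curve $(i\psi_1,i\psi_2,\psi_3)$, defined up to translations. Surfaces of $\mathbf{E}^3$ are considered up to reparametrization, orientation-preserving isometries and dilations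 of $\mathbf{E}^3$. The parabolic catenoid $C$ of axis $(1,0,1)$ is the maximal surface with $g(z)=\frac{z}{z-2i}$, $\omega=\frac{i(z-2i)^2}{2}dz$ on $\mathbb{C}$, with isotropic curve $\psi(z)=\left(\tfrac i2z^2+z-i,\,1+iz,\,z+\tfrac i2z^2\right)$. The hyperbolic rotations about $(1,0,0)$ are $$H_t=\begin{pmatrix}1&0&0\\0&\cosh t&\sinh t\\0&\sinh t&\cosh t\end{pmatrix}.$$ The Enneper surface is the minimal surface of $\mathbf{E}^3$ with $g=z$, $\omega=dz$ on $\mathbb{C}$. *)

(* Defs.v *)
From Stdlib Require Import Reals Lra.
From Coquelicot Require Import Coquelicot.

Open Scope R_scope.

Definition vec3 (T : Type) : Type := (T * T * T)%type.

Definition co1 {T : Type} (v : vec3 T) : T := fst (fst v).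
Definition co2 {T : Type} (v : vec3 T) : T := snd (fst v).
Definition co3 {T : Type} (v : vec3 T) : T := snd v.

Definition scal3 (l : R) (v : vec3 R) : vec3 R :=
  (l * co1 v, l * co2 v, l * co3 v).

Definition sub3 (v w : vec3 R) : vec3 R :=
  (co1 v - co1 w, co2 v - co2 w, co3 v - co3 w).

Definition det3 (u v w : vec3 R) : R :=
  co1 u * (co2 v * co3 w - co3 v * co2 w)
  - co2 u * (co1 v * co3 w - co3 v * co1 w)
  + co3 u * (co1 v * co2 w - co2 v * co1 w).

Definition dist3 (v w : vec3 R) : R :=
  let u := sub3 v w in sqrt (co1 u ^ 2 + co2 u ^ 2 + co3 u ^ 2).

Definition isometry_E3 (f : vec3 R -> vec3 R) : Prop :=
  forall v w, dist3 (f v) (f w) = dist3 v w.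

(* An isometry of E^3 is affine; the determinant below is that of its linear
   part, whose columns are the f e_i - f 0. *)
Definition orientation_preserving (f : vec3 R -> vec3 R) : Prop :=
  0 < det3 (sub3 (f (1, 0, 0)) (f (0, 0, 0)))
           (sub3 (f (0, 1, 0)) (f (0, 0, 0)))
           (sub3 (f (0, 0, 1)) (f (0, 0, 0))).

Definition unit_interval (s : R) : Prop := 0 <= s <= 1.

Definition path_in (Om : C -> Prop) (gam : R -> C) : Prop :=
  continuous_on unit_interval gam /\ forall s, unit_interval s -> Om (gam s).

Definition path_connected (Om : C -> Prop) : Prop :=
  forall p q, Om p -> Om q ->
    exists gam, path_in Om gam /\ gam 0 = p /\ gam 1 = q.

Definition null_homotopic (Om : C -> Prop) (gam : R -> C) : Prop :=
  exists H : R * R -> C,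
    continuous_on (fun st => unit_interval (fst st) /\ unit_interval (snd st)) H
    /\ (forall s t, unit_interval s -> unit_interval t -> Om (H (s, t)))
    /\ (forall t, unit_interval t -> H (0, t) = gam t)
    /\ (forall t, unit_interval t -> H (1, t) = gam 0)
    /\ (forall s, unit_interval s -> H (s, 0) = gam 0 /\ H (s, 1) = gam 0).

Definition simply_connected_domain (Om : C -> Prop) : Prop :=
  (exists z, Om z) /\ open Om /\ path_connected Om /\
  forall gam, path_in Om gam -> gam 0 = gam 1 -> null_homotopic Om gam.

Definition holomorphic_on (Om : C -> Prop) (f : C -> C) : Prop :=
  forall z, Om z -> @ex_derive C_AbsRing C_NormedModule f z.

Definition biholomorphic (Om Om' : C -> Prop) (h : C -> C) : Prop :=
  holomorphic_on Om h /\ (forall z, Om z -> Om' (h z)) /\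
  exists k : C -> C,
    holomorphic_on Om' k /\ (forall w, Om' w -> Om (k w)) /\
    (forall z, Om z -> k (h z) = z) /\ (forall w, Om' w -> h (k w) = w).

(* f is real-differentiable at z, and l is the value at z of the Wirtinger
   derivative df/dz = (df/dx - i df/dy) / 2. *)
Definition is_Wirtinger (f : C -> R) (z l : C) : Prop :=
  exists fx fy : R,
    differentiable_pt_lim (fun x y => f (x, y)) (Re z) (Im z) fx fy /\
    l = (/ 2 * (fx - Ci * fy))%C.

(* Parametrized surfaces; only the values of [par] on [dom] are meaningful. *)

Record surface : Type := Surface { dom : C -> Prop; par : C -> vec3 R }.

(* [par S] is a conformal minimal (eps = 1) or maximal (eps = -1) surface with
   isotropic curve phi. On a connected domain, phi = 2 dX/dz is equivalent to
   X(z) = X(z0) + Re (integral of phi from z0 to z). *)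
Definition isotropic_curve (eps : R) (S : surface) (phi : C -> vec3 C) : Prop :=
  simply_connected_domain (dom S)
  /\ (holomorphic_on (dom S) (fun z => co1 (phi z)) /\
      holomorphic_on (dom S) (fun z => co2 (phi z)) /\
      holomorphic_on (dom S) (fun z => co3 (phi z)))
  /\ (forall z, dom S z -> exists l1 l2 l3 : C,
        is_Wirtinger (fun w => co1 (par S w)) z l1 /\
        is_Wirtinger (fun w => co2 (par S w)) z l2 /\
        is_Wirtinger (fun w => co3 (par S w)) z l3 /\
        phi z = (2 * l1, 2 * l2, 2 * l3)%C)
  /\ (forall z, dom S z ->
        (co1 (phi z) * co1 (phi z) + co2 (phi z) * co2 (phi z)
         + eps * (co3 (phi z) * co3 (phi z)))%C = 0%C)
  /\ (exists z, dom S z /\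
        Cmod (co1 (phi z)) ^ 2 + Cmod (co2 (phi z)) ^ 2
        + eps * Cmod (co3 (phi z)) ^ 2 <> 0).

Definition minimal_curve := isotropic_curve 1.
Definition maximal_curve := isotropic_curve (-1).

(* (g, om dz) is the Weierstrass representation of the isotropic curve phi on
   Om. The value of the meromorphic function g is not prescribed at the zeros
   of phi1 - i phi2, where it may have a pole. *)
Definition weierstrass (Om : C -> Prop) (phi : C -> vec3 C) (g om : C -> C) :=
  forall z, Om z ->
    om z = (co1 (phi z) - Ci * co2 (phi z))%C /\
    (om z <> 0%C -> g z = (co3 (phi z) / om z)%C).

Lemma weierstrass_formula (eps : R) (S : surface) (phi : C -> vec3 C)
    (g om : C -> C) (z : C) :
  isotropic_curve eps S phi -> weierstrass (dom S) phi g om ->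
  dom S z -> om z <> 0%C ->
  phi z = (/ 2 * (1 - eps * (g z * g z)) * om z,
           Ci / 2 * (1 + eps * (g z * g z)) * om z,
           g z * om z)%C.
Proof.
intros [_ [_ [_ [Hiso _]]]] HW Hz Hom.
destruct (HW z Hz) as [Eom Eg]; specialize (Eg Hom); specialize (Hiso z Hz).
assert (E3 : co3 (phi z) = (g z * om z)%C) by (rewrite Eg; field; exact Hom).
rewrite E3 in Hiso.
destruct (phi z) as [[p1 p2] p3]; unfold co1, co2, co3 in *; simpl in *.
assert (Ci2 : (Ci * Ci = - (1))%C)
  by (unfold Ci, Cmult, Copp; simpl; f_equal; ring).
set (q := (p1 + Ci * p2)%C).
assert (Eq : q = (- eps * (g z * g z) * om z)%C).
{ assert (Hq : (om z * (q + eps * (g z * g z) * om z))%C = 0%C).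
  { rewrite <- Hiso; unfold q.
    transitivity (p1 * p1 - (Ci * Ci) * (p2 * p2)
      + eps * ((g z * om z) * (g z * om z)))%C;
      [rewrite Eom; ring | rewrite Ci2; ring]. }
  destruct (Ceq_dec (q + eps * (g z * g z) * om z)%C 0%C) as [H0 | H0].
  - replace q with ((q + eps * (g z * g z) * om z)
      - eps * (g z * g z) * om z)%C by ring.
    rewrite H0; ring.
  - exfalso; exact (Cmult_neq_0 _ _ Hom H0 Hq). }
assert (H2 : (2 : C) <> 0%C) by (intros H; injection H; lra).
f_equal; [f_equal | exact E3].
- transitivity (/ 2 * (om z + q))%C;
    [rewrite Eom; unfold q; field; exact H2 | rewrite Eq; ring].
- transitivity (Ci / 2 * (om z - q))%C; [| rewrite Eq; field; exact H2].
  rewrite Eom; unfold q.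
  transitivity (- (Ci * Ci) * p2)%C; [rewrite Ci2; ring | field; exact H2].
Qed.

(* [D] belongs to the class (up to translations) of the dual surface of [M]. *)
Definition is_dual (M D : surface) : Prop :=
  (forall z, dom D z <-> dom M z) /\
  exists psi : C -> vec3 C,
    maximal_curve M psi /\
    minimal_curve D
      (fun z => (Ci * co1 (psi z), Ci * co2 (psi z), co3 (psi z))%C).

(* Sameness up to reparametrization, orientation-preserving isometries and
   dilations; a reparametrization is a biholomorphism of the domains. *)
Definition same_surface (S S' : surface) : Prop :=
  exists (h : C -> C) (f : vec3 R -> vec3 R) (l : R),
    biholomorphic (dom S) (dom S') h /\
    isometry_E3 f /\ orientation_preserving f /\ 0 < l /\
    forall z, dom S z -> par S z = scal3 l (f (par S' (h z))).

Definition map_surface (f : vec3 R -> vec3 R) (S : surface) : surface :=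
  Surface (dom S) (fun z => f (par S z)).

Definition hyp_rot (t : R) (v : vec3 R) : vec3 R :=
  (co1 v,
   cosh t * co2 v + sinh t * co3 v,
   sinh t * co2 v + cosh t * co3 v).

Definition parabolic_catenoid_curve (z : C) : vec3 C :=
  (Ci / 2 * (z * z) + z - Ci, 1 + Ci * z, z + Ci / 2 * (z * z))%C.

(* Only the isotropic curve is prescribed, so M is any translate of the
   catenoid of axis (1, 0, 1). The same applies to [enneper] below. *)
Definition parabolic_catenoid (M : surface) : Prop :=
  (forall z, dom M z) /\ maximal_curve M parabolic_catenoid_curve.

Lemma parabolic_catenoid_weierstrass :
  weierstrass (fun _ => True) parabolic_catenoid_curve
    (fun z => z / (z - 2 * Ci))%C
    (fun z => Ci * ((z - 2 * Ci) * (z - 2 * Ci)) / 2)%C.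
Proof.
intros z _; unfold parabolic_catenoid_curve, co1, co2, co3; simpl.
assert (Ci2 : (Ci * Ci = - (1))%C)
  by (unfold Ci, Cmult, Copp; simpl; f_equal; ring).
assert (H2 : (2 : C) <> 0%C) by (intros H; injection H; lra).
assert (HCi : Ci <> 0%C) by (intros H; injection H; lra).
split.
- transitivity (Ci / 2 * (z * z) - 2 * (Ci * Ci) * z + 2 * (Ci * Ci) * Ci)%C;
    [field; exact H2 |].
  transitivity (Ci / 2 * (z * z) + z - Ci - Ci - (Ci * Ci) * z)%C;
    [rewrite Ci2; ring | ring].
- intros Hom.
  assert (Hz : (z - 2 * Ci)%C <> 0%C).
  { intros H0; apply Hom; rewrite H0; field; exact H2. }
  transitivity ((Ci / 2 * z * (z - 2 * Ci))
    / (Ci * ((z - 2 * Ci) * (z - 2 * Ci)) / 2))%C.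
  + field; repeat split; assumption.
  + f_equal.
    transitivity (Ci / 2 * (z * z) - (Ci * Ci) * z)%C;
      [field; exact H2 | rewrite Ci2; ring].
Qed.

Definition enneper (E : surface) : Prop :=
  (forall z, dom E z) /\
  exists phi : C -> vec3 C,
    minimal_curve E phi /\
    weierstrass (dom E) phi (fun z => z) (fun _ => 1%C).

Definition is_enneper (S : surface) : Prop :=
  exists E, enneper E /\ same_surface S E.

(* Main.v *)
Require Import Defs.
From Stdlib Require Import Reals Lra.
From Coquelicot Require Import Coquelicot.

(* With u = z - i, c = cosh t and s = sinh t, the dual isotropic curve is
     ((1 - u^2)/2, - c u - s (u^2 + 1)/2, i (s u + c (u^2 + 1)/2)).
   Its leading coefficient (-1/2, -s/2, i c/2) has orthogonal real and imaginary
   parts of equal norm c/2, as for the Enneper curve; this determines the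
   rotation between the two, and completing the square then gives the parameter
   w = c u + s, in which the curve (as a form in dw) is the rotated Enneper curve
   scaled by 1/c^2.
   The inverse similarity and change of parameter turn any dual surface into one
   whose derivative is the Enneper curve, so no integration constant has to be
   identified. *)

(** * Hyperbolic identities and complex constants *)

Lemma cosh_sinh_sqr (t : R) : cosh t * cosh t - sinh t * sinh t = 1.
Proof.
unfold cosh, sinh.
assert (H : exp t * exp (- t) = 1)
  by (rewrite <- exp_plus, Rplus_opp_r; exact exp_0).
nra.
Qed.

Lemma cosh_pos (t : R) : 0 < cosh t.
Proof.
unfold cosh; assert (H := exp_pos t); assert (H' := exp_pos (- t)); lra.
Qed.

Lemma Ci_sqr : (Ci * Ci = - (1))%C.
Proof. unfold Ci, Cmult, Copp; simpl; f_equal; ring. Qed.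

Lemma RtoC_opp1 : RtoC (-1) = (- (1))%C.
Proof. unfold RtoC, Copp; simpl; f_equal; ring. Qed.

Lemma C_two_neq_0 : (2 : C) <> 0%C.
Proof. intros H; injection H; lra. Qed.

(** * Complex derivatives of polynomials and calculus of Wirtinger derivatives *)

(** The coefficients stand to the right of the powers to fit [is_derive_scal_l]; the divisors 2 and
    3 make the derivative an arbitrary quadratic. *)
Lemma is_derive_cubic (k a b c z : C) :
  @is_derive C_AbsRing C_NormedModule
    (fun w => k + w * a + w * w * (b / 2) + w * w * w * (c / 3))%C z
    (a + b * z + c * (z * z))%C.
Proof.
assert (HK : forall n m : C_AbsRing, mult n m = mult m n)
  by (intros; apply Cmult_comm).
assert (I := is_derive_id (K := C_AbsRing) z).
assert (I2 := is_derive_mult _ _ _ _ _ I I HK).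
assert (I3 := is_derive_mult _ _ _ _ _ I2 I HK).
assert (S := fun f l m H => is_derive_scal_l (V := C_NormedModule) f z l m H).
replace (a + b * z + c * (z * z))%C
  with (0 + 1 * a + (1 * z + z * 1) * (b / 2)
        + ((1 * z + z * 1) * z + z * z * 1) * (c / 3))%C.
- exact (is_derive_plus _ _ _ _ _ (is_derive_plus _ _ _ _ _
    (is_derive_plus _ _ _ _ _ (is_derive_const (V := C_NormedModule) k z)
      (S _ _ a I)) (S _ _ (b / 2)%C I2)) (S _ _ (c / 3)%C I3)).
- field; split; intros H; injection H; lra.
Qed.

Lemma holomorphic_quadratic (Om : C -> Prop) (a b c : C) (f : C -> C) :
  (forall z, f z = a + b * z + c * (z * z))%C -> holomorphic_on Om f.
Proof.
intros Hf z _; eexists.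
(* The quadratic is the cubic with constant term [a], lower coefficients [b] and [2 * c], and zero
   cubic coefficient. *)
eapply is_derive_ext; [| exact (is_derive_cubic a b (2 * c)%C 0%C z)].
intros w; rewrite Hf; simpl; field.
Qed.

(** By the Cauchy-Riemann equations the partial derivatives of Re F are Re d and -Im d, and (Re d +
    i Im d)/2 = d/2. *)
Lemma is_Wirtinger_Re (F : C -> C) (z d : C) :
  @is_derive C_AbsRing C_NormedModule F z d ->
  is_Wirtinger (fun w => Re (F w)) z (/ 2 * d)%C.
Proof.
intros [_ H].
exists (Re d), (- Im d); split.
2: { destruct d as [d1 d2].
  unfold Ci, Cmult, Cminus, Cplus, Copp, RtoC, Re, Im; simpl.
  f_equal; f_equal; ring. }
intros eps.
(* Complex differentiability is measured by the modulus, [differentiable_pt_lim] by the max norm.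
   The modulus is at most sqrt 2 times the max, so tolerance and radius are both divided by sqrt
   2. *)
assert (Hs : 0 < sqrt 2) by (apply sqrt_lt_R0; lra).
destruct (H z (fun P HP => HP)
  (mkposreal _ (Rdiv_lt_0_compat _ _ (cond_pos eps) Hs))) as [del Hdel].
exists (mkposreal _ (Rdiv_lt_0_compat _ _ (cond_pos del) Hs)).
intros u v Hu Hv; simpl in Hu, Hv.
assert (Hm : Cmod ((u, v) - z)%C
    <= sqrt 2 * Rmax (Rabs (u - Re z)) (Rabs (v - Im z)))
  by exact (Cmod_2Rmax ((u, v) - z)%C).
assert (Hb : Cmod ((u, v) - z)%C < del).
{ apply Rle_lt_trans with (1 := Hm).
  rewrite Rmult_comm; apply Rlt_div_r; [exact Hs |].
  apply Rmax_lub_lt; assumption. }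
specialize (Hdel (u, v) Hb).
change (Cmod (F (u, v) - F z - ((u, v) - z) * d)%C
  <= eps / sqrt 2 * Cmod ((u, v) - z)%C) in Hdel.
apply Rle_trans with (Cmod (F (u, v) - F z - ((u, v) - z) * d)%C);
  [| apply Rle_trans with (1 := Hdel)].
(* The real remainder is the real part of the complex remainder. *)
- eapply Rle_trans; [right | apply re_le_Cmod].
  f_equal; replace (Re z, Im z) with z by exact (surjective_pairing z).
  unfold Re, Im, Cmult, Cminus, Cplus, Copp; simpl; ring.
- replace (eps * _)
    with (eps / sqrt 2 * (sqrt 2 * Rmax (Rabs (u - Re z)) (Rabs (v - Im z))))
    by (field; lra).
  apply Rmult_le_compat_l; [| exact Hm].
  apply Rlt_le, Rdiv_lt_0_compat; [apply cond_pos | exact Hs].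
Qed.

Lemma is_Wirtinger_unique (f : C -> R) (z a b : C) :
  is_Wirtinger f z a -> is_Wirtinger f z b -> a = b.
Proof.
intros (fx & fy & Hf & ->) (gx & gy & Hg & ->).
apply differentiable_pt_lim_unique in Hf, Hg.
destruct Hf as [<- <-], Hg as [<- <-]; reflexivity.
Qed.

Lemma differentiable_pt_lim_affine (p q r x y : R) :
  differentiable_pt_lim (fun u v => p * u + q * v + r) x y p q.
Proof.
intros eps; exists (mkposreal 1 Rlt_0_1); intros u v _ _.
replace (_ - _) with 0 by ring; rewrite Rabs_R0.
apply Rmult_le_pos; [apply Rlt_le, cond_pos |].
apply Rle_trans with (2 := Rmax_l _ _), Rabs_pos.
Qed.

(** Chain rule through the affine map (u, v) -> p u + q v. Two summands cover each row of [hyp_rot]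
    and of the inverse similarity used below. *)
Lemma is_Wirtinger_linear (p q : R) (f g : C -> R) (z a b : C) :
  is_Wirtinger f z a -> is_Wirtinger g z b ->
  is_Wirtinger (fun w => p * f w + q * g w) z (p * a + q * b)%C.
Proof.
intros (fx & fy & Hf & ->) (gx & gy & Hg & ->).
exists (p * fx + q * gx), (p * fy + q * gy); split.
- eapply differentiable_pt_lim_ext;
    [| exact (differentiable_pt_lim_comp _ _ _ _ _ _ _ _ _ _ _
         (differentiable_pt_lim_affine p q 0 _ _) Hf Hg)].
  exists (mkposreal 1 Rlt_0_1); intros; simpl; ring.
- rewrite !RtoC_plus, !RtoC_mult; ring.
Qed.

(** Since r is real, the substitution scales x and y separately: its Jacobian is r times the
    identity. *)
Lemma is_Wirtinger_comp_affine (r : R) (b : C) (f : C -> R) (z a : C) :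
  is_Wirtinger f (r * z + b)%C a ->
  is_Wirtinger (fun w => f (r * w + b)%C) z (r * a)%C.
Proof.
intros (fx & fy & Hf & ->).
exists (r * fx), (r * fy); split; [| rewrite !RtoC_mult; ring].
assert (Hk : forall u v, (r * (u, v) + b)%C = (r * u + Re b, r * v + Im b)).
{ intros u v; unfold Cmult, Cplus, Re, Im; simpl; f_equal; ring. }
rewrite (surjective_pairing z), Hk in Hf.
replace (r * fx) with (fx * r + fy * 0) by ring.
replace (r * fy) with (fx * 0 + fy * r) by ring.
eapply differentiable_pt_lim_ext with
  (f1 := fun u v => f (r * u + 0 * v + Re b, 0 * u + r * v + Im b)).
- exists (mkposreal 1 Rlt_0_1); intros; rewrite Hk; do 2 f_equal; ring.
- apply (differentiable_pt_lim_comp (fun u v => f (u, v)));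
    try apply differentiable_pt_lim_affine.
  replace (_ + _ + Re b) with (r * Re z + Re b) by ring.
  replace (_ + _ + Im b) with (r * Im z + Im b) by ring.
  exact Hf.
Qed.

(** * Surfaces with a given derivative *)

(** The clause phi = 2 dX/dz of [isotropic_curve] taken alone: it passes through real linear maps
    and affine reparametrizations, while isotropy is checked on explicit formulas. *)
Definition derivative_curve (S : surface) (phi : C -> vec3 C) : Prop :=
  forall z, dom S z ->
    is_Wirtinger (fun w => co1 (par S w)) z (/ 2 * co1 (phi z))%C /\
    is_Wirtinger (fun w => co2 (par S w)) z (/ 2 * co2 (phi z))%C /\
    is_Wirtinger (fun w => co3 (par S w)) z (/ 2 * co3 (phi z))%C.

Lemma isotropic_derivative_curve (eps : R) (S : surface) (phi : C -> vec3 C) :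
  isotropic_curve eps S phi -> derivative_curve S phi.
Proof.
intros (_ & _ & H & _) z Hz.
destruct (H z Hz) as (l1 & l2 & l3 & H1 & H2 & H3 & ->).
unfold co1, co2, co3; simpl.
assert (H0 : forall l : C, (/ 2 * (2 * l))%C = l)
  by (intros; field; exact C_two_neq_0).
rewrite !H0; auto.
Qed.

(** Wirtinger derivatives are unique. This identifies the curve bound by the existential in
    [is_dual] with an explicit one. *)
Lemma derivative_curve_unique (S : surface) (phi psi : C -> vec3 C) (z : C) :
  derivative_curve S phi -> derivative_curve S psi -> dom S z -> phi z = psi z.
Proof.
intros Hphi Hpsi Hz.
destruct (Hphi z Hz) as (A1 & A2 & A3), (Hpsi z Hz) as (B1 & B2 & B3).
assert (K : forall a b : C, (/ 2 * a)%C = (/ 2 * b)%C -> a = b).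
{ intros a b H; replace a with (2 * (/ 2 * a))%C by (field; exact C_two_neq_0).
  rewrite H; field; exact C_two_neq_0. }
assert (E1 := K _ _ (is_Wirtinger_unique _ _ _ _ A1 B1)).
assert (E2 := K _ _ (is_Wirtinger_unique _ _ _ _ A2 B2)).
assert (E3 := K _ _ (is_Wirtinger_unique _ _ _ _ A3 B3)).
destruct (phi z) as [[? ?] ?], (psi z) as [[? ?] ?].
unfold co1, co2, co3 in *; simpl in *; congruence.
Qed.

(** The curves built below are quadratic polynomials with coefficients [q0], [q1], [q2], so
    holomorphy is automatic; one point [z0] witnesses nondegeneracy. *)
Lemma isotropic_curve_intro (eps : R) (S : surface) (phi : C -> vec3 C)
    (q0 q1 q2 : vec3 C) (z0 : C) :
  simply_connected_domain (dom S) ->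
  (forall z, phi z = (co1 q0 + co1 q1 * z + co1 q2 * (z * z),
                      co2 q0 + co2 q1 * z + co2 q2 * (z * z),
                      co3 q0 + co3 q1 * z + co3 q2 * (z * z))%C) ->
  derivative_curve S phi ->
  (forall z, (co1 (phi z) * co1 (phi z) + co2 (phi z) * co2 (phi z)
              + eps * (co3 (phi z) * co3 (phi z)))%C = 0%C) ->
  dom S z0 ->
  Cmod (co1 (phi z0)) ^ 2 + Cmod (co2 (phi z0)) ^ 2
    + eps * Cmod (co3 (phi z0)) ^ 2 <> 0 ->
  isotropic_curve eps S phi.
Proof.
intros Hsc Hq Hd Hiso Hz0 Hnd; split; [exact Hsc |].
split; [| split; [| split; [auto | exists z0; auto]]].
- split; [| split].
  + apply holomorphic_quadratic with (co1 q0) (co1 q1) (co1 q2).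
    intros z; rewrite Hq; reflexivity.
  + apply holomorphic_quadratic with (co2 q0) (co2 q1) (co2 q2).
    intros z; rewrite Hq; reflexivity.
  + apply holomorphic_quadratic with (co3 q0) (co3 q1) (co3 q2).
    intros z; rewrite Hq; reflexivity.
- intros z Hz; destruct (Hd z Hz) as (H1 & H2 & H3).
  exists (/ 2 * co1 (phi z))%C, (/ 2 * co2 (phi z))%C, (/ 2 * co3 (phi z))%C.
  repeat (split; [assumption |]).
  rewrite (surjective_pairing (phi z)) at 1.
  rewrite (surjective_pairing (fst (phi z))) at 1.
  unfold co1, co2, co3; f_equal; [f_equal |]; field; exact C_two_neq_0.
Qed.

(** Real part of the antiderivative vanishing at 0; the summand 0 is the constant [k] of
    [is_derive_cubic]. *)
Definition quadratic_primitive (q0 q1 q2 : vec3 C) (w : C) : vec3 R :=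
  let p a b c := Re (0 + w * a + w * w * (b / 2) + w * w * w * (c / 3))%C in
  (p (co1 q0) (co1 q1) (co1 q2),
   p (co2 q0) (co2 q1) (co2 q2),
   p (co3 q0) (co3 q1) (co3 q2)).

Lemma quadratic_primitive_derivative (dm : C -> Prop) (q0 q1 q2 : vec3 C) :
  derivative_curve (Surface dm (quadratic_primitive q0 q1 q2))
    (fun z => (co1 q0 + co1 q1 * z + co1 q2 * (z * z),
               co2 q0 + co2 q1 * z + co2 q2 * (z * z),
               co3 q0 + co3 q1 * z + co3 q2 * (z * z))%C).
Proof.
assert (K : forall a b c z : C,
  is_Wirtinger
    (fun w => Re (0 + w * a + w * w * (b / 2) + w * w * w * (c / 3))%C)
    z (/ 2 * (a + b * z + c * (z * z)))%C)
  by (intros; apply is_Wirtinger_Re, is_derive_cubic).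
intros z _; split; [| split]; apply K.
Qed.

(** * The rotated catenoid and existence of its dual *)

Definition rotated_curve (t : R) (z : C) : vec3 C :=
  let p := parabolic_catenoid_curve z in
  (co1 p, cosh t * co2 p + sinh t * co3 p,
   sinh t * co2 p + cosh t * co3 p)%C.

(** H_t is real linear, hence commutes with d/dz; its complexification acts on the isotropic
    curve. *)
Lemma rotated_curve_derivative (M : surface) (t : R) :
  parabolic_catenoid M ->
  derivative_curve (map_surface (hyp_rot t) M) (rotated_curve t).
Proof.
intros [_ HM] z Hz.
destruct (isotropic_derivative_curve _ _ _ HM z Hz) as (H1 & H2 & H3).
split; [exact H1 |].
unfold rotated_curve, co1, co2, co3 in *; simpl in *.
split.
- replace (/ 2 * _)%C with
    (cosh t * (/ 2 * (1 + Ci * z)) + sinh t * (/ 2 * (z + Ci / 2 * (z * z))))%C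
    by (field; exact C_two_neq_0).
  exact (is_Wirtinger_linear _ _ _ _ _ _ _ H2 H3).
- replace (/ 2 * _)%C with
    (sinh t * (/ 2 * (1 + Ci * z)) + cosh t * (/ 2 * (z + Ci / 2 * (z * z))))%C
    by (field; exact C_two_neq_0).
  exact (is_Wirtinger_linear _ _ _ _ _ _ _ H2 H3).
Qed.

Definition dual_curve (psi : C -> vec3 C) (z : C) : vec3 C :=
  (Ci * co1 (psi z), Ci * co2 (psi z), co3 (psi z))%C.

Lemma cosh_sinh_sqr_C (t : R) :
  (cosh t * cosh t)%C = (1 + sinh t * sinh t)%C.
Proof.
rewrite <- !RtoC_mult, <- RtoC_plus; f_equal.
assert (H := cosh_sinh_sqr t); lra.
Qed.

(** H_t preserves the Lorentz form, through c^2 - s^2 = 1. As psi1 = psi3 - i, the form of psi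
    itself collapses to i^2 + 1 = 0. *)
Lemma rotated_curve_isotropic (t : R) (z : C) :
  let p := rotated_curve t z in
  (co1 p * co1 p + co2 p * co2 p + (-1)%R * (co3 p * co3 p))%C = 0%C.
Proof.
unfold rotated_curve, parabolic_catenoid_curve, co1, co2, co3; simpl.
set (p3 := (z + Ci / 2 * (z * z))%C).
replace (Ci / 2 * (z * z) + z - Ci)%C with (p3 - Ci)%C by (unfold p3; ring).
transitivity ((p3 - Ci) * (p3 - Ci)
  + (cosh t * cosh t - sinh t * sinh t)
    * ((1 + Ci * z) * (1 + Ci * z) - p3 * p3))%C.
- rewrite RtoC_opp1; ring.
- rewrite cosh_sinh_sqr_C.
  transitivity (Ci * Ci + 1)%C;
    [unfold p3; field; exact C_two_neq_0 | rewrite Ci_sqr; ring].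
Qed.

(** The point 0 witnesses nondegeneracy twice: the Hermitian value there is 1 + c^2 - s^2 = 2 for
    the rotated curve and 1 + c^2 + s^2 for its dual. *)
Lemma rotated_curve_0 (t : R) :
  rotated_curve t 0 = (- Ci, RtoC (cosh t), RtoC (sinh t))%C.
Proof.
unfold rotated_curve, parabolic_catenoid_curve, co1, co2, co3; simpl.
f_equal; [f_equal |]; ring.
Qed.

Lemma Cmod_Ci : Cmod Ci = 1.
Proof.
unfold Cmod, Ci; simpl.
replace (_ + _) with 1 by ring; exact sqrt_1.
Qed.

Lemma Cmod_RtoC_sqr (r : R) : Cmod r ^ 2 = r * r.
Proof. rewrite Cmod_R, pow2_abs; ring. Qed.

Lemma rotated_catenoid_maximal (M : surface) (t : R) :
  parabolic_catenoid M ->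
  maximal_curve (map_surface (hyp_rot t) M) (rotated_curve t).
Proof.
intros HM.
apply isotropic_curve_intro with
  (- Ci, RtoC (cosh t), RtoC (sinh t))%C
  (RtoC 1, cosh t * Ci + sinh t, sinh t * Ci + cosh t)%C
  (Ci / 2, sinh t * (Ci / 2), cosh t * (Ci / 2))%C
  (RtoC 0).
- destruct HM as (_ & H & _); exact H.
- intros z; unfold rotated_curve, parabolic_catenoid_curve, co1, co2, co3; simpl.
  f_equal; [f_equal |]; ring.
- apply rotated_curve_derivative, HM.
- apply rotated_curve_isotropic.
- apply (proj1 HM).
- rewrite rotated_curve_0; unfold co1, co2, co3; simpl fst; simpl snd.
  rewrite Cmod_opp, Cmod_Ci, !Cmod_RtoC_sqr.
  assert (H := cosh_sinh_sqr t); nra.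
Qed.

Lemma rotated_catenoid_dual_exists (M : surface) (t : R) :
  parabolic_catenoid M ->
  exists D, is_dual (map_surface (hyp_rot t) M) D.
Proof.
intros HM.
(* Coefficients of 1, z, z^2 in the rotated curve, the first two coordinates being multiplied by i;
   the dual surface is their explicit primitive. *)
pose (q0 := (- (Ci * Ci), Ci * cosh t, RtoC (sinh t))%C).
pose (q1 := (Ci, Ci * (cosh t * Ci + sinh t), sinh t * Ci + cosh t)%C).
pose (q2 := (Ci * (Ci / 2), Ci * (sinh t * (Ci / 2)), cosh t * (Ci / 2))%C).
exists (Surface (dom M) (quadratic_primitive q0 q1 q2)).
split; [reflexivity |].
exists (rotated_curve t); split; [exact (rotated_catenoid_maximal M t HM) |].
assert (Hq : forall z, dual_curve (rotated_curve t) z =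
  (co1 q0 + co1 q1 * z + co1 q2 * (z * z),
   co2 q0 + co2 q1 * z + co2 q2 * (z * z),
   co3 q0 + co3 q1 * z + co3 q2 * (z * z))%C).
{ intros z; unfold dual_curve, rotated_curve, parabolic_catenoid_curve, q0, q1, q2.
  unfold co1, co2, co3; simpl.
  f_equal; [f_equal |]; ring. }
apply (isotropic_curve_intro 1 _ (dual_curve (rotated_curve t)) q0 q1 q2 (RtoC 0)).
- destruct HM as (_ & H & _); exact H.
- exact Hq.
- intros z Hz; rewrite Hq; exact (quadratic_primitive_derivative _ _ _ _ z Hz).
- intros z; assert (H := rotated_curve_isotropic t z); cbv zeta in H.
  (* The Euclidean form of (i a, i b, d) is minus the Lorentz form of (a, b, d). *)
  transitivity (- 0)%C; [rewrite <- H, RtoC_opp1 | ring].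
  unfold dual_curve; destruct (rotated_curve t z) as [[a b] d].
  unfold co1, co2, co3; simpl.
  transitivity ((Ci * Ci) * (a * a + b * b) + d * d)%C; [ring |].
  rewrite Ci_sqr; ring.
- apply (proj1 HM).
- unfold dual_curve; rewrite rotated_curve_0.
  unfold co1, co2, co3; simpl fst; simpl snd.
  rewrite !Cmod_mult, Cmod_opp, Cmod_Ci, Cmod_RtoC_sqr, Rmult_1_l.
  rewrite Rpow_mult_distr, Cmod_RtoC_sqr; nra.
Qed.

(** * Recognizing Enneper surfaces and dual surfaces by their derivatives *)

Definition enneper_curve (w : C) : vec3 C :=
  (/ 2 * (1 - w * w), Ci / 2 * (1 + w * w), w)%C.

Lemma enneper_curve_enneper (E : surface) :
  simply_connected_domain (dom E) -> (forall z, dom E z) ->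
  derivative_curve E enneper_curve -> enneper E.
Proof.
intros Hsc Hdom Hd; split; [exact Hdom |].
exists enneper_curve; split.
- apply isotropic_curve_intro with
    (/ 2, Ci / 2, RtoC 0)%C (RtoC 0, RtoC 0, RtoC 1)%C (- / 2, Ci / 2, RtoC 0)%C (RtoC 0).
  + exact Hsc.
  + intros z; unfold enneper_curve, co1, co2, co3; simpl.
    f_equal; [f_equal |]; field; exact C_two_neq_0.
  + exact Hd.
  + intros z; unfold enneper_curve, co1, co2, co3; simpl.
    (* Uses (1 - z^2)^2 + 4 z^2 = (1 + z^2)^2. *)
    transitivity ((Ci * Ci + 1) * (/ 2 * / 2 * ((1 + z * z) * (1 + z * z))))%C;
      [field; exact C_two_neq_0 | rewrite Ci_sqr; ring].
  + apply Hdom.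
  + unfold enneper_curve, co1, co2, co3; simpl fst; simpl snd.
    replace (/ 2 * (1 - 0 * 0))%C with (RtoC (/ 2))
      by (rewrite RtoC_inv by lra; ring).
    rewrite Cmod_0, Cmod_RtoC_sqr.
    assert (H := pow2_ge_0 (Cmod (Ci / 2 * (1 + 0 * 0))%C)); lra.
- intros z _; unfold enneper_curve, co1, co2, co3; simpl; split.
  + transitivity (/ 2 * (1 - z * z) - (Ci * Ci) * / 2 * (1 + z * z))%C;
      [rewrite Ci_sqr |]; field; exact C_two_neq_0.
  + intros _; field.
Qed.

Lemma is_dual_curve (M D : surface) (psi : C -> vec3 C) :
  derivative_curve M psi -> is_dual M D -> derivative_curve D (dual_curve psi).
Proof.
intros Hpsi (Hdom & psi' & HM & HD) z Hz.
replace (dual_curve psi z) with (dual_curve psi' z).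
- exact (isotropic_derivative_curve _ _ _ HD z Hz).
- unfold dual_curve.
  rewrite (derivative_curve_unique M psi' psi z); auto.
  + exact (isotropic_derivative_curve _ _ _ HM).
  + apply Hdom, Hz.
Qed.

(** * The similarity and the parameter change leading to Enneper's surface *)

Definition enneper_coord (t : R) (z : C) : C :=
  (cosh t * z + (sinh t - cosh t * Ci))%C.

(** Solves w = c (z - i) + s for z, in the form of a real multiple of w plus a constant required by
    [is_Wirtinger_comp_affine]. *)
Definition enneper_coord_inv (t : R) (w : C) : C :=
  ((/ cosh t)%R * w + (Ci - (sinh t / cosh t)%R))%C.

(** The rotation taking Enneper's leading coefficient (-1/2, i/2, 0) to 1/c times (-1/2, -s/2, i
    c/2); the image of the third axis is then forced by orientation. *)
Definition enneper_motion (t : R) (v : vec3 R) : vec3 R :=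
  ((co1 v + sinh t * co3 v) / cosh t,
   (sinh t * co1 v - co3 v) / cosh t,
   co2 v).

(* The zero summand gives each coordinate the shape of [is_Wirtinger_linear]. *)
Definition enneper_of_dual (t : R) (D : surface) : surface :=
  Surface (dom D) (fun w =>
    let v := par D (enneper_coord_inv t w) in
    (cosh t * co1 v + cosh t * sinh t * co2 v,
     cosh t * cosh t * co3 v + 0 * co3 v,
     cosh t * sinh t * co1 v + (- cosh t) * co2 v)).

Lemma RtoC_cosh_neq_0 (t : R) : RtoC (cosh t) <> 0%C.
Proof.
intros H; injection H; assert (H' := cosh_pos t); lra.
Qed.

Lemma enneper_coordK (t : R) (z : C) :
  enneper_coord_inv t (enneper_coord t z) = z.
Proof.
assert (H := cosh_pos t); unfold enneper_coord, enneper_coord_inv.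
rewrite RtoC_inv, RtoC_div by lra; field; apply RtoC_cosh_neq_0.
Qed.

Lemma enneper_coord_invK (t : R) (w : C) :
  enneper_coord t (enneper_coord_inv t w) = w.
Proof.
assert (H := cosh_pos t); unfold enneper_coord, enneper_coord_inv.
rewrite RtoC_inv, RtoC_div by lra; field; apply RtoC_cosh_neq_0.
Qed.

Lemma enneper_coord_biholomorphic (t : R) (Om : C -> Prop) :
  (forall z, Om z) -> biholomorphic Om Om (enneper_coord t).
Proof.
intros HOm; split; [| split; [auto |]].
- apply holomorphic_quadratic with
    (sinh t - cosh t * Ci)%C (RtoC (cosh t)) (RtoC 0).
  intros z; unfold enneper_coord; ring.
- exists (enneper_coord_inv t); split; [| split; [auto | split]].
  + apply holomorphic_quadratic with
      (Ci - (sinh t / cosh t)%R)%C (RtoC (/ cosh t)) (RtoC 0).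
    intros z; unfold enneper_coord_inv; ring.
  + intros z _; apply enneper_coordK.
  + intros w _; apply enneper_coord_invK.
Qed.

Lemma enneper_motion_isometry (t : R) : isometry_E3 (enneper_motion t).
Proof.
intros [[v1 v2] v3] [[w1 w2] w3].
unfold dist3, enneper_motion, sub3, co1, co2, co3; simpl; f_equal.
assert (Hc := cosh_pos t); assert (H := cosh_sinh_sqr t).
set (x := v1 - w1); set (z := v3 - w3).
replace ((v1 + sinh t * v3) / cosh t - (w1 + sinh t * w3) / cosh t)
  with ((x + sinh t * z) / cosh t) by (unfold x, z; field; lra).
replace ((sinh t * v1 - v3) / cosh t - (sinh t * w1 - w3) / cosh t)
  with ((sinh t * x - z) / cosh t) by (unfold x, z; field; lra).
(* Clearing denominators leaves (x + s z)^2 + (s x - z)^2 = (1 + s^2)(x^2 + z^2), where 1 + s^2 =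
   c^2. *)
apply Rmult_eq_reg_l with (cosh t * cosh t); [| nra].
transitivity ((1 + sinh t * sinh t) * (x * x + z * z)
  + cosh t * cosh t * ((v2 - w2) * (v2 - w2))); [field; lra |].
replace (1 + sinh t * sinh t) with (cosh t * cosh t) by lra; ring.
Qed.

Lemma enneper_motion_orientation (t : R) :
  orientation_preserving (enneper_motion t).
Proof.
unfold orientation_preserving, enneper_motion, det3, sub3, co1, co2, co3; simpl.
assert (Hc := cosh_pos t); assert (H := cosh_sinh_sqr t).
replace (_ + _) with ((1 + sinh t * sinh t) * / (cosh t * cosh t))
  by (field; lra).
apply Rmult_lt_0_compat; [| apply Rinv_0_lt_compat]; nra.
Qed.

(** The shift u = z - i turns the catenoid curve into i ((u^2 - 1)/2, u, (u^2 + 1)/2), from which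
    rotation and duality are read off. *)
Lemma dual_rotated_curve (t : R) (u : C) :
  dual_curve (rotated_curve t) (u + Ci)%C =
  (/ 2 * (1 - u * u), - (cosh t * u) - sinh t / 2 * (u * u + 1),
   Ci * (sinh t * u + cosh t / 2 * (u * u + 1)))%C.
Proof.
assert (Hp : (u + Ci + Ci / 2 * ((u + Ci) * (u + Ci)))%C
             = (Ci / 2 * (u * u + 1))%C).
{ transitivity (u + Ci + Ci / 2 * (u * u + Ci * Ci) + (Ci * Ci) * u)%C;
    [field; exact C_two_neq_0 |].
  rewrite Ci_sqr; field; exact C_two_neq_0. }
unfold dual_curve, rotated_curve, parabolic_catenoid_curve, co1, co2, co3; simpl.
rewrite Hp.
replace (1 + Ci * (u + Ci))%C with (1 + Ci * Ci + Ci * u)%C by ring.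
replace (Ci / 2 * ((u + Ci) * (u + Ci)) + (u + Ci) - Ci)%C
  with (Ci / 2 * (u * u + 1) - Ci)%C by (rewrite <- Hp; ring).
rewrite Ci_sqr.
f_equal; [f_equal |].
- transitivity ((Ci * Ci) * (/ 2 * (u * u + 1) - 1))%C;
    [| rewrite Ci_sqr]; field; exact C_two_neq_0.
- transitivity ((Ci * Ci) * (cosh t * u + sinh t / 2 * (u * u + 1)))%C;
    [| rewrite Ci_sqr]; field; exact C_two_neq_0.
- field; exact C_two_neq_0.
Qed.

(** The parameter change contributes a factor 1/c and the linear map acts on the curve; three
    polynomial identities in u, with w = c u + s, remain. *)
Lemma enneper_of_dual_curve (t : R) (D : surface) :
  (forall z, dom D z) ->
  derivative_curve D (dual_curve (rotated_curve t)) ->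
  derivative_curve (enneper_of_dual t D) enneper_curve.
Proof.
intros Hdom HD w _.
assert (Hc := RtoC_cosh_neq_0 t); assert (H2 := C_two_neq_0).
destruct (HD (enneper_coord_inv t w) (Hdom _)) as (H1 & H3 & H4).
pose (b := (Ci - (sinh t / cosh t)%R)%C).
assert (K1 := is_Wirtinger_comp_affine (/ cosh t) b _ w _ H1).
assert (K2 := is_Wirtinger_comp_affine (/ cosh t) b _ w _ H3).
assert (K3 := is_Wirtinger_comp_affine (/ cosh t) b _ w _ H4).
set (u := ((w - sinh t) / cosh t)%C).
assert (Hz : enneper_coord_inv t w = (u + Ci)%C).
{ unfold enneper_coord_inv, u.
  rewrite RtoC_inv, RtoC_div by (assert (H := cosh_pos t); lra); field; exact Hc. }
assert (Hw : w = (cosh t * u + sinh t)%C) by (unfold u; field; exact Hc).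
assert (Hu : dual_curve (rotated_curve t) (enneper_coord_inv t w) =
  (/ 2 * (1 - u * u), - (cosh t * u) - sinh t / 2 * (u * u + 1),
   Ci * (sinh t * u + cosh t / 2 * (u * u + 1)))%C).
{ rewrite Hz; apply dual_rotated_curve. }
rewrite Hu in K1, K2, K3; clearbody u; clear Hu Hz.
assert (Hcc := cosh_sinh_sqr_C t).
assert (Hi : RtoC (/ cosh t) = (/ cosh t)%C)
  by (apply RtoC_inv; assert (H := cosh_pos t); lra).
unfold co1, co2, co3 in K1, K2, K3; simpl in K1, K2, K3.
split; [| split].
- replace (/ 2 * co1 (enneper_curve w))%C with
    (cosh t * ((/ cosh t)%R * (/ 2 * (/ 2 * (1 - u * u))))
     + (cosh t * sinh t)%R * ((/ cosh t)%R
         * (/ 2 * (- (cosh t * u) - sinh t / 2 * (u * u + 1)))))%C.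
  + exact (is_Wirtinger_linear (cosh t) (cosh t * sinh t) _ _ _ _ _ K1 K2).
  + rewrite Hw; unfold enneper_curve, co1; simpl.
    rewrite Hi, RtoC_mult.
    (* Isolates 1 + s^2 as the coefficient of u^2; replacing it by c^2 completes the square (c u +
       s)^2. *)
    transitivity (/ 2 * / 2 * (1 - u * u * (1 + sinh t * sinh t)
      - sinh t * (2 * cosh t * u + sinh t)))%C; [field; auto |].
    rewrite <- Hcc; field; auto.
- replace (/ 2 * co2 (enneper_curve w))%C with
    ((cosh t * cosh t)%R * ((/ cosh t)%R * (/ 2 *
         (Ci * (sinh t * u + cosh t / 2 * (u * u + 1)))))
     + 0 * ((/ cosh t)%R * (/ 2 *
         (Ci * (sinh t * u + cosh t / 2 * (u * u + 1))))))%C.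
  + exact (is_Wirtinger_linear (cosh t * cosh t) 0 _ _ _ _ _ K3 K3).
  + rewrite Hw; unfold enneper_curve, co2; simpl.
    rewrite Hi, RtoC_mult.
    transitivity (Ci / 2 * / 2 * (2 * sinh t * cosh t * u
      + cosh t * cosh t * u * u + cosh t * cosh t))%C; [field; auto |].
    (* Only the constant term c^2 becomes 1 + s^2, which gives 1 + (c u + s)^2. *)
    rewrite Hcc at 2; field; auto.
- replace (/ 2 * co3 (enneper_curve w))%C with
    ((cosh t * sinh t)%R * ((/ cosh t)%R * (/ 2 * (/ 2 * (1 - u * u))))
     + (- cosh t)%R * ((/ cosh t)%R
         * (/ 2 * (- (cosh t * u) - sinh t / 2 * (u * u + 1)))))%C.
  + exact (is_Wirtinger_linear (cosh t * sinh t) (- cosh t) _ _ _ _ _ K1 K2).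
  + rewrite Hw; unfold enneper_curve, co3; simpl.
    rewrite Hi, RtoC_mult, RtoC_opp; field; auto.
Qed.

(** [enneper_of_dual] applies c^2 times the inverse of [enneper_motion], so the dilation back to D
    has ratio 1/c^2. *)
Lemma enneper_of_dual_same (t : R) (D : surface) :
  (forall z, dom D z) -> same_surface D (enneper_of_dual t D).
Proof.
intros Hdom.
assert (Hc := cosh_pos t); assert (H := cosh_sinh_sqr t).
exists (enneper_coord t), (enneper_motion t), (/ (cosh t * cosh t)).
split; [exact (enneper_coord_biholomorphic t _ Hdom) |].
split; [exact (enneper_motion_isometry t) |].
split; [exact (enneper_motion_orientation t) |].
split; [apply Rinv_0_lt_compat; nra |].
intros z _; unfold enneper_of_dual; simpl; rewrite enneper_coordK.
destruct (par D z) as [[x y] v].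
unfold enneper_motion, scal3, co1, co2, co3; simpl.
assert (Hs : / (cosh t * cosh t) * (1 + sinh t * sinh t) = 1)
  by (replace (1 + sinh t * sinh t) with (cosh t * cosh t) by lra; field; lra).
f_equal; [f_equal |].
(* Writing the factor 1 as (1 + s^2)/c^2 makes the equation a rational identity for [field]. *)
- rewrite <- (Rmult_1_l x) at 1; rewrite <- Hs; field; lra.
- rewrite <- (Rmult_1_l y) at 1; rewrite <- Hs; field; lra.
- field; lra.
Qed.

Theorem theorem5p4 :
  forall (M : surface) (t : R),
    parabolic_catenoid M ->
    (exists D : surface, is_dual (map_surface (hyp_rot t) M) D) /\
    (forall D : surface,
       is_dual (map_surface (hyp_rot t) M) D -> is_enneper D).
Proof.
intros M t HM; split; [exact (rotated_catenoid_dual_exists M t HM) |].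
intros D HD.
assert (Hdom : forall z, dom D z)
  by (intros z; apply (proj1 HD); exact (proj1 HM z)).
exists (enneper_of_dual t D); split; [| exact (enneper_of_dual_same t D Hdom)].
apply enneper_curve_enneper; [| exact Hdom |].
(* Simple connectedness is part of D being a minimal surface. *)
- destruct HD as (_ & psi & _ & Hsc & _); exact Hsc.
- apply enneper_of_dual_curve; [exact Hdom |].
  exact (is_dual_curve _ _ _ (rotated_curve_derivative M t HM) HD).
Qed.
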